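(* Let $R$ be any associative ring with $1$. Let $\mathcal A_{cyc}$ be the class of all cyclic finitely presented left $R$-modules, i.e. modules of the form $R/I$ with $I$ a finitely generated left ideal. Let $\Gamma_1$ be the set of all finite sums of unary pp formulas of the form $\exists y(x=ay\wedge\bar b y=0)$ with $a\in R$ and $\bar b$ an arbitrary (finite) column vector over $R$. Then the following are equivalent. \begin{itemize} \item[(1)] $R\text{-Mod}$ has the $\Gamma_1$-dcc. \item[(1$'$)] $\mathrm{Add}(\mathcal A_{cyc})$ has the $\Gamma_1$-dcc. \item[(2)] Every direct limit of modules from $\mathrm{add}(\mathcal A_{cyc})$ is Mittag-Leffler. \end{itemize}
   Context: All modules are unitary left $R$-modules; $R\text{-Mod}$ is the class of all of them. For a class $\mathcal K$ of modules, $\mathrm{Add}(\mathcal K)$ (resp. $\mathrm{add}(\mathcal K)$) is the class of all direct summands of direct sums (resp. of finite direct sums) of modules from $\mathcal K$, closed under isomorphism. A positive primitive (pp) formula in variables $\bar x$ is one of the form $\exists\bar y\,(A\bar y=B\bar x)$ with $A,B$ matrices over $R$ of matching sizes; it is unary if $\bar x$ has length $1$. The sum of pp formulas $\varphi,\psi$ of the same arity is the pp formula $\exists\bar u\,\exists\bar v\,(\bar x=\bar u+\bar v\wedge\varphi(\bar u)\wedge\psi(\bar v))$. For pp formulas of the same arity, $\varphi\le\psi$ means $\varphi(M)\subseteq\psi(M)$ for every $M\in R\text{-Mod}$. The pp type $\mathrm{pp}_M(\bar a)$ of a finite tuple $\bar a$ in $M$ is the set of all pp formulas satisfied by $\bar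 a$ in $M$. It is finitely generated if it contains a formula $\varphi$ with $\varphi\le\psi$ for every $\psi\in\mathrm{pp}_M(\bar a)$. A module is Mittag-Leffler if the pp type of every finite tuple in it is finitely generated. A class $\mathcal K\subseteq R\text{-Mod}$ has the $\Gamma$-dcc, for a set $\Gamma$ of pp formulas, if for every $K\in\mathcal K$ and every descending chain $\gamma_0(\bar x)\ge\gamma_1(\bar x)\ge\dots$ of formulas from $\Gamma$ of the same arity, the descending chain of subgroups $\gamma_i(K)$ of $K^{l(\bar x)}$ stabilizes. *)

(* Defs.v *)
From HB Require Import structures.
From mathcomp Require Import all_boot all_order all_algebra.
From mathcomp Require Import boolp classical_sets cardinality.

Set Implicit Arguments.
Unset Strict Implicit.
Unset Printing Implicit Defensive.

Import Order.TTheory GRing.Theory.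
Local Open Scope classical_set_scope.
Local Open Scope ring_scope.

Definition lmod_iso (R : pzRingType) (M N : lmodType R) : Prop :=
  exists f : {linear M -> N}, bijective f.

(* The external direct sum of an arbitrary family of modules: functions of   *)
(* finite support.                                                           *)
Section DirectSum.
Variables (R : pzRingType) (I : Type) (M : I -> lmodType R).

Record dsum : Type := DSum {
  dsum_fun :> forall i, M i;
  dsum_fin : finite_set [set i | dsum_fun i != 0] }.

HB.instance Definition _ := gen_eqMixin dsum.
HB.instance Definition _ := gen_choiceMixin dsum.

Lemma dsumP (x y : dsum) : (forall i, x i = y i) -> x = y.
Proof.
case: x y => [x hx] [y hy] /= xy.
have exy : x = y by apply: functional_extensionality_dep.
by case: y / exy hy {xy} => hy; rewrite (Prop_irrelevance hx hy).
Qed.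

Lemma dsum0_fin : finite_set [set i | (0 : M i) != 0].
Proof.
by rewrite (_ : mkset _ = set0) // -subset0 => i /=; rewrite eqxx.
Qed.

Lemma dsumD_fin (x y : dsum) : finite_set [set i | x i + y i != 0].
Proof.
have hU : finite_set ([set i | x i != 0] `|` [set i | y i != 0]).
  by rewrite finite_setU; split; exact: dsum_fin.
apply: sub_finite_set hU => i /=.
have [->|xi] := eqVneq (x i) 0; last by left.
by rewrite add0r; right.
Qed.

Lemma dsumN_fin (x : dsum) : finite_set [set i | - x i != 0].
Proof.
by apply: sub_finite_set (dsum_fin x) => i /=; rewrite oppr_eq0.
Qed.

Lemma dsumZ_fin (a : R) (x : dsum) : finite_set [set i | a *: x i != 0].
Proof.
apply: sub_finite_set (dsum_fin x) => i /=.
by apply: contra_neq => ->; rewrite scaler0.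
Qed.

Let zero := DSum dsum0_fin.
Let opp x := DSum (dsumN_fin x).
Let add x y := DSum (dsumD_fin x y).
Let scale a x := DSum (dsumZ_fin a x).

Let addA : associative add.
Proof. by move=> x y z; apply: dsumP => i; apply: addrA. Qed.
Let addC : commutative add.
Proof. by move=> x y; apply: dsumP => i; apply: addrC. Qed.
Let add0 : left_id zero add.
Proof. by move=> x; apply: dsumP => i; apply: add0r. Qed.
Let addN : left_inverse zero opp add.
Proof. by move=> x; apply: dsumP => i; apply: addNr. Qed.

HB.instance Definition _ := GRing.isZmodule.Build dsum addA addC add0 addN.

Let scaleA a b v : scale a (scale b v) = scale (a * b) v.
Proof. by apply: dsumP => i; apply: scalerA. Qed.
Let scale1 : left_id 1 scale.
Proof. by move=> x; apply: dsumP => i; apply: scale1r. Qed.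
Let scaleDr : right_distributive scale +%R.
Proof. by move=> a x y; apply: dsumP => i; apply: scalerDr. Qed.
Let scaleDl v : {morph scale^~ v : a b / a + b}.
Proof. by move=> a b; apply: dsumP => i; apply: scalerDl. Qed.

HB.instance Definition _ :=
  GRing.Zmodule_isLmodule.Build R dsum scaleA scale1 scaleDr scaleDl.

End DirectSum.

(* The left ideal generated by the entries of b, and the left module R / I.  *)
Section CyclicQuotient.
Variables (R : pzRingType) (k : nat) (b : 'cV[R]_k).

Definition lideal : {pred R^o} :=
  fun r => `[< exists c : 'I_k -> R, r = \sum_i c i * b i 0 >].

Lemma lidealP (r : R) :
  reflect (exists c : 'I_k -> R, r = \sum_i c i * b i 0) (r \in lideal).
Proof. exact: asboolP. Qed.

Lemma lideal_zmod_closed : zmod_closed lideal.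
Proof.
split; first by apply/lidealP; exists (fun=> 0); rewrite big1// => i; rewrite mul0r.
move=> _ _ /lidealP[c ->] /lidealP[d ->]; apply/lidealP.
by exists (fun i => c i - d i); rewrite -sumrB; apply: eq_bigr => i _; rewrite mulrBl.
Qed.

HB.instance Definition _ := GRing.isZmodClosed.Build R^o lideal lideal_zmod_closed.

Lemma lideal_scale (a x : R) : x \in lideal -> a * x \in lideal.
Proof.
move=> /lidealP[c ->]; apply/lidealP; exists (fun i => a * c i).
by rewrite mulr_sumr; apply: eq_bigr => i _; rewrite mulrA.
Qed.

Definition lquot : Type := Quotient.quot (lideal : zmodClosed R^o).
HB.instance Definition _ := GRing.Zmodule.on lquot.

Definition lquot_pi (x : R^o) : lquot := (\pi_(Quotient.quot (lideal : zmodClosed R^o)) x)%qT.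
Let rep (q : lquot) : R^o := repr q.

Let repK q : lquot_pi (rep q) = q. Proof. exact: reprK. Qed.

Lemma lquot_piP (x y : R) : (lquot_pi x = lquot_pi y) <-> (x - y \in lideal).
Proof. by rewrite /lquot_pi; split => [/eqP|h]; [|apply/eqP]; rewrite -Quotient.idealrBE. Qed.

Lemma lquot_piD x y : lquot_pi (x + y) = lquot_pi x + lquot_pi y. Proof. exact: Quotient.pi_add. Qed.

Definition lquot_scale (a : R) (q : lquot) : lquot := lquot_pi (a * rep q).

Lemma lquot_scale_pi (a x : R) : lquot_scale a (lquot_pi x) = lquot_pi (a * x).
Proof. by apply/lquot_piP; rewrite -mulrBr; apply/lideal_scale/lquot_piP/repK. Qed.

Let scaleA a c v : lquot_scale a (lquot_scale c v) = lquot_scale (a * c) v.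
Proof. by rewrite -[v]repK !lquot_scale_pi mulrA. Qed.
Let scale1 : left_id 1 lquot_scale.
Proof. by move=> v; rewrite -[v]repK lquot_scale_pi mul1r. Qed.
Let scaleDr : right_distributive lquot_scale +%R.
Proof. by move=> a x y; rewrite -[x]repK -[y]repK -lquot_piD !lquot_scale_pi mulrDr lquot_piD. Qed.
Let scaleDl v : {morph lquot_scale^~ v : a c / a + c}.
Proof. by move=> a c; rewrite -[v]repK !lquot_scale_pi mulrDl lquot_piD. Qed.

HB.instance Definition _ :=
  GRing.Zmodule_isLmodule.Build R lquot scaleA scale1 scaleDr scaleDl.

End CyclicQuotient.

Definition cyclic_fp (R : pzRingType) (M : lmodType R) : Prop :=
  exists (k : nat) (b : 'cV[R]_k), lmod_iso M (lquot b).

Definition direct_summand (R : pzRingType) (M N : lmodType R) : Prop :=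
  exists M' : lmodType R, lmod_iso (M * M')%type N.

Definition Add_class (R : pzRingType) (K : lmodType R -> Prop) (M : lmodType R) :=
  exists (I : Type) (N : I -> lmodType R),
    (forall i, K (N i)) /\ direct_summand M (dsum N).

Definition add_class (R : pzRingType) (K : lmodType R -> Prop) (M : lmodType R) :=
  exists (n : nat) (N : 'I_n -> lmodType R),
    (forall i, K (N i)) /\ direct_summand M (dsum N).

Definition directed d (I : porderType d) : Prop :=
  inhabited I /\ forall i j : I, exists k : I, (i <= k)%O /\ (j <= k)%O.

Record direct_system (R : pzRingType) d (I : porderType d) := DirectSystem {
  ds_obj :> I -> lmodType R;
  ds_map : forall i j : I, (i <= j)%O -> {linear ds_obj i -> ds_obj j};
  ds_id : forall (i : I) (le_ii : (i <= i)%O) x, ds_map le_ii x = x;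
  ds_comp : forall (i j k : I) (le_ij : (i <= j)%O) (le_jk : (j <= k)%O)
    (le_ik : (i <= k)%O) x, ds_map le_jk (ds_map le_ij x) = ds_map le_ik x }.

Section DirectLimit.
Variables (R : pzRingType) (d : Order.disp_t) (I : porderType d).
Variable S : direct_system R I.

Definition is_cocone (L : lmodType R) (f : forall i, {linear S i -> L}) : Prop :=
  forall (i j : I) (le_ij : (i <= j)%O) (x : S i), f j (ds_map S le_ij x) = f i x.

Definition is_direct_limit (L : lmodType R) : Prop :=
  exists f : forall i, {linear S i -> L}, is_cocone f /\
    forall (X : lmodType R) (g : forall i, {linear S i -> X}), is_cocone g ->
      exists h : {linear L -> X}, (forall i x, h (f i x) = g i x) /\
        forall h' : {linear L -> X}, (forall i x, h' (f i x) = g i x) -> h' =1 h.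

End DirectLimit.

(* A matrix over R acting on a column of module elements.                    *)
Definition mxact (R : pzRingType) (M : lmodType R) (m n : nat)
    (A : 'M[R]_(m, n)) (x : 'cV[M]_n) : 'cV[M]_m :=
  \col_i \sum_j A i j *: x j 0.

(* The formula  exists y, A y = B x  in the n-tuple of variables x.          *)
Record ppform (R : pzRingType) (n : nat) := PPForm {
  pp_rows : nat;
  pp_bound : nat;
  pp_lhs : 'M[R]_(pp_rows, pp_bound);
  pp_rhs : 'M[R]_(pp_rows, n) }.

Definition pp_sat (R : pzRingType) (n : nat) (phi : ppform R n)
    (M : lmodType R) : set 'cV[M]_n :=
  [set x | exists y : 'cV[M]_(pp_bound phi),
     mxact (pp_lhs phi) y = mxact (pp_rhs phi) x].
Arguments pp_sat {R n} phi M _.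

Definition pp_le (R : pzRingType) (n : nat) (phi psi : ppform R n) : Prop :=
  forall M : lmodType R, pp_sat phi M `<=` pp_sat psi M.

(* With bound variables (u, v, y, z), the rows read                          *)
(*   u + v = x,  A_phi y - B_phi u = 0,  A_psi z - B_psi v = 0.              *)
Definition pp_sum (R : pzRingType) (n : nat) (phi psi : ppform R n) :
    ppform R n :=
  PPForm
    (block_mx (row_mx 1%:M 1%:M) 0
              (block_mx (- pp_rhs phi) 0 0 (- pp_rhs psi))
              (block_mx (pp_lhs phi) 0 0 (pp_lhs psi)))
    (col_mx 1%:M 0 : 'M[R]_(n + (pp_rows phi + pp_rows psi), n)).

(* The formula  exists y, x = a y /\ b y = 0.                                *)
Definition pp_cyc (R : pzRingType) (a : R) (k : nat) (b : 'cV[R]_k) :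
    ppform R 1 :=
  PPForm (col_mx a%:M b) (col_mx 1%:M 0 : 'M[R]_(1 + k, 1)).

Section PPFacts.
Variables (R : pzRingType) (M : lmodType R).

Lemma mxact_mul m n p (A : 'M[R]_(m, n)) (B : 'M[R]_(n, p)) (x : 'cV[M]_p) :
  mxact A (mxact B x) = mxact (A *m B) x.
Proof.
apply/matrixP => i j; rewrite !mxE.
under eq_bigr do rewrite mxE scaler_sumr.
rewrite exchange_big /=; apply: eq_bigr => l _; rewrite mxE scaler_suml.
by apply: eq_bigr => q _; rewrite scalerA.
Qed.

Lemma mxact1 n (x : 'cV[M]_n) : mxact 1%:M x = x.
Proof.
apply/colP => i; rewrite !mxE (bigD1 i) //= mxE eqxx scale1r big1 ?addr0 // => j ji.
by rewrite mxE eq_sym (negPf ji) scale0r.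
Qed.

Lemma mxact0 m n (x : 'cV[M]_n) : mxact (0 : 'M[R]_(m, n)) x = 0.
Proof. by apply/colP => i; rewrite !mxE big1 // => j _; rewrite mxE scale0r. Qed.

Lemma mxactN m n (A : 'M[R]_(m, n)) (x : 'cV[M]_n) : mxact (- A) x = - mxact A x.
Proof.
by apply/colP => i; rewrite !mxE -sumrN; apply: eq_bigr => j _; rewrite mxE scaleNr.
Qed.

Lemma mxact_row m n p (A : 'M[R]_(m, n)) (B : 'M[R]_(m, p))
    (x : 'cV[M]_n) (y : 'cV[M]_p) :
  mxact (row_mx A B) (col_mx x y) = mxact A x + mxact B y.
Proof.
apply/colP => i; rewrite !mxE big_split_ord /=; congr (_ + _);
  by apply: eq_bigr => j _; rewrite ?(row_mxEl, row_mxEr) ?(col_mxEu, col_mxEd).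
Qed.

Lemma mxact_col m n p (A : 'M[R]_(m, n)) (B : 'M[R]_(p, n)) (x : 'cV[M]_n) :
  mxact (col_mx A B) x = col_mx (mxact A x) (mxact B x).
Proof.
apply/colP => i; rewrite -[i]splitK; case: (split i) => j /=;
by rewrite ?(col_mxEu, col_mxEd) !mxE; apply: eq_bigr => l _;
  rewrite ?(col_mxEu, col_mxEd).
Qed.

Lemma pp_sumP n (phi psi : ppform R n) (x : 'cV[M]_n) :
  pp_sat (pp_sum phi psi) M x <->
  exists u v : 'cV[M]_n, [/\ x = u + v, pp_sat phi M u & pp_sat psi M v].
Proof.
have E (u v : 'cV[M]_n) y z :
    mxact (pp_lhs (pp_sum phi psi)) (col_mx (col_mx u v) (col_mx y z))
    = col_mx (u + v) (col_mx (mxact (pp_lhs phi) y - mxact (pp_rhs phi) u)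
                             (mxact (pp_lhs psi) z - mxact (pp_rhs psi) v)).
  rewrite /pp_sum /= /block_mx !(mxact_col, mxact_row) !mxact1 !mxact0 !mxactN.
  by rewrite !(addr0, add0r) add_col_mx; congr (col_mx _ (col_mx _ _)); apply: addrC.
have F : mxact (pp_rhs (pp_sum phi psi)) x = col_mx x 0.
  by rewrite /= mxact_col mxact1 mxact0.
split=> [[w]|[u [v [-> [y hy] [z hz]]]]]; last first.
  exists (col_mx (col_mx u v) (col_mx y z)).
  by rewrite E /= mxact_col mxact1 mxact0 hy hz !subrr col_mx0.
rewrite F -[w]vsubmxK -[usubmx w]vsubmxK -[dsubmx w]vsubmxK E -col_mx0.
move=> /eq_col_mx[<- /eq_col_mx[/eqP + /eqP]]; rewrite !subr_eq0 => /eqP hy /eqP hz.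
by do 2!eexists; split; first reflexivity; [exists (usubmx (dsubmx w))|exists (dsubmx (dsubmx w))].
Qed.

Lemma pp_cycP (a : R) k (b : 'cV[R]_k) (x : M) :
  pp_sat (pp_cyc a b) M (const_mx x) <->
  exists y : M, x = a *: y /\ forall i, b i 0 *: y = 0.
Proof.
have Ea (y : M) : mxact a%:M (const_mx y : 'cV[M]_1) = const_mx (a *: y).
  by apply/colP => i; rewrite !mxE big_ord1 !mxE !ord1 eqxx.
have Eb (y : M) : mxact b (const_mx y : 'cV[M]_1) = \col_i (b i 0 *: y).
  by apply/colP => i; rewrite !mxE big_ord1 !mxE.
have F : mxact (pp_rhs (pp_cyc a b)) (const_mx x) = col_mx (const_mx x) 0.
  by rewrite /= mxact_col mxact1 mxact0.
split=> [[w]|[y [-> hy]]]; last first.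
  exists (const_mx y); rewrite /= !mxact_col Ea Eb mxact1 mxact0.
  by congr col_mx; apply/colP => i; rewrite !mxE.
have -> : w = const_mx (w 0 0) by apply/colP => i; rewrite !mxE ord1.
rewrite F /= mxact_col Ea Eb => /eq_col_mx[/colP/(_ 0) + /colP h].
rewrite !mxE => <-; exists (w 0 0); split=> // i.
by have := h i; rewrite !mxE.
Qed.

End PPFacts.

Definition pp_type (R : pzRingType) (M : lmodType R) (n : nat) (a : 'cV[M]_n) :
    set (ppform R n) :=
  [set phi | pp_sat phi M a].

Definition pp_type_fg (R : pzRingType) (M : lmodType R) (n : nat)
    (a : 'cV[M]_n) : Prop :=
  exists2 phi, pp_type a phi & forall psi, pp_type a psi -> pp_le phi psi.

Definition mittag_leffler (R : pzRingType) (M : lmodType R) : Prop :=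
  forall (n : nat) (a : 'cV[M]_n), pp_type_fg a.

(* A set of pp formulas is given by its members of each arity n.             *)
Definition has_dcc (R : pzRingType) (Gamma : forall n, set (ppform R n))
    (K : lmodType R -> Prop) : Prop :=
  forall M : lmodType R, K M ->
  forall (n : nat) (gamma : nat -> ppform R n),
    (forall i, Gamma n (gamma i)) ->
    (forall i, pp_le (gamma i.+1) (gamma i)) ->
    exists N : nat, forall i, (N <= i)%N ->
      pp_sat (gamma i) M = pp_sat (gamma N) M.

(* The empty sum is not listed separately: it is pp_cyc with a = 0.          *)
Inductive Gamma1 (R : pzRingType) : forall n, set (ppform R n) :=
| Gamma1_cyc (a : R) (k : nat) (b : 'cV[R]_k) : Gamma1 (pp_cyc a b)
| Gamma1_sum (phi psi : ppform R 1) :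
    Gamma1 phi -> Gamma1 psi -> Gamma1 (pp_sum phi psi).

(* Main.v *)
From HB Require Import structures.
Require Import Defs.
From mathcomp Require Import all_boot all_order all_algebra.
From mathcomp Require Import boolp classical_sets cardinality.

Set Implicit Arguments.
Unset Strict Implicit.
Unset Printing Implicit Defensive.

Import Order.TTheory GRing.Theory.
Local Open Scope classical_set_scope.
Local Open Scope ring_scope.

(** Fix n and regard pp formulas in n variables as subfunctors of the functor
    sending X to X^n.  A finite list s of n-tuples, each lying in a cyclic
    finitely presented module R/I, generates the subfunctor [gen s]: at X it
    consists of the sums of images of the tuples of s under linear maps to X.
    The formulas of Gamma_1 define subfunctors of this form ([Gamma1_gen]).  For
    every n, each [gen s] is defined by a pp formula ([gen_formula]), and these
    formulas are the ones freely realized by tuples in modules of add(A_cyc)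
    ([add_class_realizes], [realizes_add_class]).

    That (1) implies (1') is clear.

    From (1') to (2), the key is that (1') makes strict inclusion between the
    subfunctors [gen s] well founded, for every n ([fg_wf]).  For subfunctors with a
    single generator this is [cyclic_gen_wf].  A chain of such subfunctors comes
    from a sequence of maps between modules R/I_i; because R/I_0 is generated by
    a single element, the whole chain is controlled by the images of that
    element, hence by a descending chain of formulas
    exists y (x = r_i y /\ b_i y = 0).  Such a chain stops in the direct sum of
    all the R/I_i.  The passage from one generator to finitely many is the
    theorem of J.-E. Bjork that a module with the descending chain condition on
    cyclic submodules has it on finitely generated ones, here for modules over
    a ring with several objects.

    Given a tuple a in a direct limit L of modules M_i from add(A_cyc), each
    preimage of a in a module M_i determines such a subfunctor.  A preimage whose
    subfunctor is minimal has a defining formula that generates the pp type of a,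
    since a pp formula true in L is already true at some later stage
    ([pp_sat_limit]).

    From (2) to (1), a descending chain in Gamma_1 is realized by a sequence of
    pointed modules (D_i, m_i) of add(A_cyc) with maps sending m_i to m_(i+1).
    In the limit, the pp type of the common image of the m_i is the union of the
    pp types of the m_i; if it is finitely generated, then its generator already
    belongs to some stage, and the chain is constant from there on.  This needs
    an explicit direct limit ([concrete_limit_exists]). *)

(** * Linear maps out of cyclic modules and direct sums *)

Lemma linear_pack (R : pzRingType) (U V : lmodType R) (f : U -> V) :
  linear f -> exists g : {linear U -> V}, g =1 f.
Proof.
move=> fL; pose m := GRing.isLinear.Build R U V *:%R f fL.
pose g : {linear U -> V} := HB.pack f m.
by exists g.
Qed.

Section CyclicModules.
Variable R : pzRingType.

(** The modules R/I are indexed by their presentations, so that tuples in them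
    form a type in the universe of R. *)
Definition presentation := {k : nat & 'cV[R]_k}.

HB.instance Definition _ := Choice.on presentation.

Definition rels (t : presentation) : 'cV[R]_(tag t) := tagged t.

Definition cyc (t : presentation) : lmodType R := lquot (rels t).

Definition cyc_gen (t : presentation) : cyc t := lquot_pi (rels t) 1.

Lemma cyc_scale t (r : R) : r *: cyc_gen t = lquot_pi (rels t) r.
Proof. by rewrite [LHS]lquot_scale_pi mulr1. Qed.

Lemma cyc_genP t (q : cyc t) : exists r : R, q = r *: cyc_gen t.
Proof. by exists (repr q); rewrite cyc_scale; symmetry; exact: reprK. Qed.

Lemma cyc_gen_rel t (i : 'I_(tag t)) : rels t i 0 *: cyc_gen t = 0.
Proof.
rewrite -[RHS](scale0r (cyc_gen t)) !cyc_scale; apply/lquot_piP/lidealP.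
exists (fun j => (j == i)%:R).
rewrite subr0 (bigD1 i) //= eqxx mul1r big1 ?addr0 // => j /negPf ->.
by rewrite mul0r.
Qed.

Lemma cyc_lift t (M : lmodType R) (y : M) :
  (forall i, rels t i 0 *: y = 0) ->
  exists h : {linear cyc t -> M}, h (cyc_gen t) = y.
Proof.
move=> hy; have kill (r s : R) :
    lquot_pi (rels t) r = lquot_pi (rels t) s -> r *: y = s *: y.
  move=> /lquot_piP /lidealP[c e]; apply/eqP; rewrite -subr_eq0 -scalerBl e.
  by rewrite scaler_suml big1 // => i _; rewrite -scalerA hy scaler0.
pose f (q : cyc t) : M := (repr q : R) *: y.
have fE (r : R) : f (r *: cyc_gen t) = r *: y.
  by apply: kill; rewrite cyc_scale; exact: reprK.
have fL : linear f.
  move=> a u v; have [r ->] := cyc_genP u; have [s ->] := cyc_genP v.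
  by rewrite scalerA -scalerDl !fE scalerDl scalerA.
have [h hE] := linear_pack fL.
by exists h; rewrite hE -[cyc_gen t]scale1r fE scale1r.
Qed.

End CyclicModules.

Section DirectSumMaps.
Variables (R : pzRingType) (I : choiceType) (M : I -> lmodType R).

Lemma dsum_proj (i : I) : exists p : {linear dsum M -> M i}, forall x, p x = x i.
Proof. by apply: (linear_pack (f := fun x : dsum M => x i)). Qed.

Lemma dsum_inj (i : I) : exists j : {linear M i -> dsum M},
  (forall x, j x i = x) /\ forall x k, i != k -> j x k = 0.
Proof.
have fin (x : M i) : finite_set [set k | dfwith (fun k => 0 : M k) x k != 0].
  apply: (@sub_finite_set _ _ [set i]); last exact: finite_set1.
  move=> k /=; have [-> //|ki] := eqVneq k i.
  by rewrite dfwith_out ?eqxx // eq_sym.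
have fL : linear (fun x => DSum (fin x)).
  move=> a x y; apply: dsumP => k /=.
  change (dfwith (fun k => 0 : M k) (a *: x + y) k =
    a *: dfwith (fun k => 0 : M k) x k + dfwith (fun k => 0 : M k) y k).
  have [->|ik] := eqVneq k i; first by rewrite !dfwith_in.
  by rewrite !dfwith_out 1?eq_sym // scaler0 addr0.
have [j jE] := linear_pack fL; exists j; split=> [x|x k ik]; rewrite jE /=.
  exact: dfwith_in.
exact: dfwith_out.
Qed.

End DirectSumMaps.

Lemma dsum_fun_sum (R : pzRingType) (I J : choiceType) (M : I -> lmodType R)
    (r : seq J) (F : J -> dsum M) (i : I) :
  (\sum_(j <- r) F j : dsum M) i = \sum_(j <- r) F j i.
Proof. by elim/big_rec2: _ => // j x y _ <-. Qed.

Lemma direct_summand_refl (R : pzRingType) (M : lmodType R) :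
  direct_summand M M.
Proof.
exists 'cV[R]_0.
have [f fE] := linear_pack (f := (fun x => x.1 : M) : (M * 'cV[R]_0)%type -> M)
  (fun a u v => erefl).
exists f; exists (fun x => (x, 0)) => [[x y]|x]; rewrite fE //=.
by congr pair; apply/colP; case.
Qed.

Lemma lmod_iso_inv (R : pzRingType) (M N : lmodType R) : lmod_iso M N ->
  exists (f : {linear M -> N}) (g : {linear N -> M}), cancel f g /\ cancel g f.
Proof.
move=> [f [g fK gK]]; have gL : linear g.
  by move=> a x y; apply: (can_inj fK); rewrite linearP !gK.
have [g' gE] := linear_pack gL.
by exists f, g'; split=> x; rewrite gE.
Qed.

Lemma direct_summand_retract (R : pzRingType) (M N : lmodType R) :
  direct_summand M N ->
  exists (f : {linear M -> N}) (g : {linear N -> M}), cancel f g.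
Proof.
move=> [M' /lmod_iso_inv [f [g [fK _]]]].
have iL : linear (fun x : M => (x, 0 : M')).
  by move=> a x y; congr pair => //=; rewrite scaler0 addr0.
have [i iE] := linear_pack iL.
have [p pE] := linear_pack (f := (fun x => x.1 : M) : (M * M')%type -> M)
  (fun a u v => erefl).
exists (f \o i : {linear M -> N}), (p \o g : {linear N -> M}) => x /=.
by rewrite fK iE pE.
Qed.

(** A module of add(A_cyc) is used only through finitely many maps to and from
    cyclic modules that split its identity. *)
Lemma add_class_retract (R : pzRingType) (M : lmodType R) :
  add_class (@cyclic_fp R) M ->
  exists (m : nat) (t : 'I_m -> presentation R)
    (f : forall j, {linear M -> cyc (t j)})
    (g : forall j, {linear cyc (t j) -> M}),
    forall x, x = \sum_j g j (f j x).
Proof.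
move=> [m [N [Ncyc /direct_summand_retract [f [g fK]]]]].
have /choice [t tE] : forall j, exists t : presentation R, exists
    (f : {linear N j -> cyc t}) (g : {linear cyc t -> N j}), cancel f g.
  move=> j; have [k [b /lmod_iso_inv [f' [g' [fK' _]]]]] := Ncyc j.
  by exists (Tagged (fun k => 'cV[R]_k) b), f', g'.
pose a j := projT1 (cid (tE j)); pose b j := projT1 (cid (projT2 (cid (tE j)))).
have abK j : cancel (a j) (b j) := projT2 (cid (projT2 (cid (tE j)))).
pose p j := projT1 (cid (dsum_proj N j)).
have pE j x : p j x = x j := projT2 (cid (dsum_proj N j)) x.
pose i j := projT1 (cid (dsum_inj N j)).
have iE j := projT2 (cid (dsum_inj N j)).
exists m, t, (fun j => a j \o (p j \o f)), (fun j => g \o (i j \o b j)) => x /=.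
under eq_bigr => j _ do rewrite abK pE.
rewrite -linear_sum -[LHS]fK; congr (g _); apply: dsumP => k.
rewrite dsum_fun_sum (bigD1 k) //= (iE k).1 big1 ?addr0 // => j jk.
exact: (iE j).2.
Qed.

(** * Subfunctors of X |-> X^n generated by tuples in cyclic modules *)

Section Subfunctors.
Variables (R : pzRingType) (n : nat).

(** Defining a subfunctor on all modules, and not only on the cyclic ones, makes
    [subp] the order of pp formulas. *)
Definition tuple_pred := forall X : lmodType R, 'cV[X]_n -> Prop.
Implicit Types S A B : tuple_pred.

Definition subp S A : Prop := forall X x, S X x -> A X x.

Definition subfunctor S : Prop :=
  [/\ forall X, S X 0, forall X x y, S X x -> S X y -> S X (x + y) &
      forall (X Y : lmodType R) (f : {linear X -> Y}) x, S X x -> S Y (map_mx f x)].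

Lemma subfunctor_sum S (X : lmodType R) (I : Type) (r : seq I)
    (F : I -> 'cV[X]_n) :
  subfunctor S -> (forall i, S X (F i)) -> S X (\sum_(i <- r) F i).
Proof.
move=> [S0 SD _] SF; elim/big_rec: _ => [|i x _ Sx]; first exact: S0.
exact: SD.
Qed.

Lemma subfunctor_map S (X Y : lmodType R) (f : {linear X -> Y}) x :
  subfunctor S -> S X x -> S Y (map_mx f x).
Proof. by case=> _ _; apply. Qed.

Lemma subfunctorN S X x : subfunctor S -> S X x -> S X (- x).
Proof.
move=> [_ _ Sm] Sx; have [g gE] := linear_pack (f := fun x : X => - x)
  (fun a x y => etrans (opprD _ _) (congr1 (+%R^~ _) (esym (scalerN _ _)))).
have -> : - x = map_mx g x by apply/colP => i; rewrite !mxE gE.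
exact: Sm.
Qed.

Lemma subfunctorB S X x y : subfunctor S -> S X x -> S X y -> S X (x - y).
Proof.
by move=> Ssub Sx Sy; case: (Ssub) => _ SD _; apply: SD => //; exact: subfunctorN.
Qed.

Definition plusp A B : tuple_pred :=
  fun X x => exists y z, [/\ A X y, B X z & x = y + z].

Lemma plusp_subfunctor A B : subfunctor A -> subfunctor B ->
  subfunctor (plusp A B).
Proof.
move=> [A0 AD Am] [B0 BD Bm]; split=> [X|X _ _ [x [y [Ax By ->]]] [x' [y' [Ax' By' ->]]]
  |X Y f _ [x [y [Ax By ->]]]].
- by exists 0, 0; rewrite addr0.
- exists (x + x'), (y + y').
  by rewrite addrACA; split; auto.
- exists (map_mx f x), (map_mx f y).
  by rewrite map_mxD; split; auto.
Qed.

Lemma subp_plusl A B : subfunctor B -> subp A (plusp A B).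
Proof. by case=> B0 _ _ X x Ax; exists x, 0; rewrite addr0. Qed.

Lemma subp_plusr A B : subfunctor A -> subp B (plusp A B).
Proof. by case=> A0 _ _ X x Bx; exists 0, x; rewrite add0r. Qed.

Lemma plusp_sub A B S : subfunctor S -> subp A S -> subp B S ->
  subp (plusp A B) S.
Proof. by case=> _ SD _ AS BS X _ [x [y [Ax By ->]]]; apply: SD; auto. Qed.

Definition element := {t : presentation R & 'cV[cyc t]_n}.
Definition el_val (e : element) : 'cV[cyc (tag e)]_n := tagged e.
HB.instance Definition _ := Choice.on element.

Definition mk_el (t : presentation R) (x : 'cV[cyc t]_n) : element :=
  Tagged (fun t => 'cV[cyc t]_n) x.

(** One linear map per generator is enough, because sums of linear maps are
    linear. *)
Fixpoint gen (s : seq element) : tuple_pred := fun X x =>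
  if s is e :: s' then
    exists (f : {linear cyc (tag e) -> X}) y,
      gen s' y /\ x = map_mx f (el_val e) + y
  else x = 0.

Lemma gen_subfunctor s : subfunctor (gen s).
Proof.
elim: s => [|e s [s0 sD sm]] /=.
  split=> [//|X x y -> ->|X Y f x ->]; first by rewrite addr0.
  by rewrite map_mx0.
split=> [X|X _ _ [f [y [sy ->]]] [g [z [sz ->]]]|X Y g _ [f [y [sy ->]]]].
- exists \0, 0; split; first exact: s0.
  by rewrite addr0; apply/colP => i; rewrite !mxE.
- exists (f \+ g), (y + z); split; first exact: sD.
  by rewrite addrACA; congr (_ + _); apply/colP => i; rewrite !mxE.
- exists (g \o f), (map_mx g y); split; first exact: sm.
  by rewrite map_mxD; congr (_ + _); apply/colP => i; rewrite !mxE.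
Qed.

Lemma gen_mem (s : seq element) (e : element) : e \in s -> gen s (el_val e).
Proof.
elim: s => //= e' s IHs; rewrite in_cons; have [->|_ /= es] := eqVneq e e'.
  have [s0 _ _] := gen_subfunctor s => _; exists idfun, 0; split; first exact: s0.
  by rewrite addr0; apply/colP => i; rewrite mxE.
exists \0, (el_val e); split; first exact: IHs.
by apply/colP => i; rewrite !mxE add0r.
Qed.

Lemma gen_sub (s : seq element) S : subfunctor S ->
  (forall e, e \in s -> S _ (el_val e)) -> subp (gen s) S.
Proof.
move=> [S0 SD Sm]; elim: s => [|e s IHs] Ss X x /= => [->|[f [y [sy ->]]]].
  exact: S0.
apply: SD; first by apply/Sm/Ss; rewrite in_cons eqxx.
by apply: IHs => // e' e's; apply: Ss; rewrite in_cons e's orbT.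
Qed.

Lemma gen_cons e s (X : lmodType R) (x : 'cV[X]_n) :
  gen (e :: s) x <-> plusp (gen [:: e]) (gen s) x.
Proof.
split=> [[f [y [sy ->]]]|[y [z [[f [_ [-> ->]]] sz ->]]]].
  by exists (map_mx f (el_val e)), y; split=> //; exists f, 0; rewrite addr0.
by exists f, z; rewrite addr0.
Qed.

Lemma gen_cat s s' (X : lmodType R) (x : 'cV[X]_n) :
  gen (s ++ s') x <-> plusp (gen s) (gen s') x.
Proof.
elim: s x => [|e s IHs] x /=.
  split=> [sx|[_ [y [-> sy ->]]]]; last by rewrite add0r.
  by exists 0, x; rewrite add0r.
split=> [[f [_ [/IHs [y [z [sy sz ->]] ->]]]]|[_ [z [[f [y [sy ->]]] sz ->]]]].
  by exists (map_mx f (el_val e) + y), z; rewrite addrA; split=> //; exists f, y.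
by exists f, (y + z); rewrite addrA; split=> //; apply/IHs; exists y, z.
Qed.

Lemma gen1P (e : element) (X : lmodType R) (x : 'cV[X]_n) :
  gen [:: e] x <-> exists f : {linear cyc (tag e) -> X}, x = map_mx f (el_val e).
Proof.
split=> [[f [_ [-> ->]]]|[f ->]]; first by exists f; rewrite addr0.
by exists f, 0; rewrite addr0.
Qed.

Definition gen_lt (s' s : seq element) : Prop :=
  subp (gen s') (gen s) /\ ~ subp (gen s) (gen s').

(** The descending chain condition on the finitely generated subfunctors of S,
    in the form of well-founded induction. *)
Definition dcc_fg S : Prop := forall s, subp (gen s) S -> Acc gen_lt s.

Lemma subp_trans S A B : subp S A -> subp A B -> subp S B.
Proof. by move=> SA AB X x /SA /AB. Qed.

End Subfunctors.

(** * From one generator to finitely many *)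

Lemma wf_min (T : Type) (lt : T -> T -> Prop) (P : T -> Prop) :
  well_founded lt -> (exists x, P x) ->
  exists m, P m /\ forall y, P y -> ~ lt y m.
Proof.
move=> wf [x Px]; apply: contrapT => noMin; elim/(well_founded_ind wf): x Px.
by move=> x IHx Px; apply: noMin; exists x; split=> // y Py yx; exact: IHx yx Py.
Qed.

Section FinitelyGenerated.
Variables (R : pzRingType) (n : nat).
Local Notation element := (element R n).
Local Notation tuple_pred := (tuple_pred R n).
Implicit Types (A B S : tuple_pred) (s D : seq element).

Hypothesis cyc_wf : well_founded (fun e' e : element => gen_lt [:: e'] [:: e]).

Lemma dcc_sub A B : subp A B -> dcc_fg B -> dcc_fg A.
Proof. by move=> AB dB s sA; apply: dB; exact: subp_trans sA AB. Qed.

Lemma gen_subset s s' : {subset s <= s'} -> subp (gen s) (gen s').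
Proof.
by move=> ss'; apply: gen_sub; [exact: gen_subfunctor|move=> e /ss' /gen_mem].
Qed.

Lemma gen_sub1 (e : element) S : subfunctor S -> S _ (el_val e) ->
  subp (gen [:: e]) S.
Proof. by move=> Ssub Se; apply: gen_sub => // e'; rewrite inE => /eqP ->. Qed.

Lemma gen_cons_sub (e : element) s S : subfunctor S -> S _ (el_val e) ->
  subp (gen s) S -> subp (gen (e :: s)) S.
Proof.
move=> Ssub Se sS; apply: gen_sub => // e'; rewrite in_cons => /orP[/eqP ->//|].
by move=> /gen_mem /sS.
Qed.

(** Each generator of s is b + f y with b in B; the elements b are the
    remaining generators D, and they lie in [gen s] because y does. *)
Lemma gen_extract B s t (y : 'cV[cyc t]_n) : subfunctor B ->
  subp (gen s) (plusp B (gen [:: mk_el y])) -> gen s y ->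
  exists D, [/\ subp (gen D) B, subp (gen D) (gen s) &
    subp (gen s) (gen (mk_el y :: D))].
Proof.
move=> Bsub sB sy; have ssub := gen_subfunctor s.
suff H r : {subset r <= s} -> exists D, [/\ subp (gen D) B, subp (gen D) (gen s) &
    subp (gen r) (gen (mk_el y :: D))] by exact: H.
elim: r => [|e r IHr] rs.
  exists [::]; split; try by apply: gen_sub.
  by apply: gen_subset.
have [|D [DB Ds rD]] := IHr; first by move=> e' e'r; apply: rs; rewrite in_cons e'r orbT.
have es : gen s (el_val e) by apply/gen_mem/rs; rewrite in_cons eqxx.
have [b [_ [Bb /gen1P [f ->] eE]]] := sB _ _ es.
have sb : gen s b.
  have -> : b = el_val e - map_mx f y by rewrite eE addrK.
  by apply: subfunctorB => //; apply: subfunctor_map.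
exists (mk_el b :: D); split; try exact: gen_cons_sub.
have Dsub := gen_subfunctor (mk_el y :: mk_el b :: D).
apply: gen_cons_sub => //.
  rewrite eE addrC; exists f, b; split=> //; apply: (@gen_mem _ _ _ (mk_el b)).
  by rewrite in_cons eqxx.
apply: (subp_trans rD); apply: gen_subset => e'.
by rewrite !in_cons => /orP[->//|->]; rewrite !orbT.
Qed.

(** The core of the argument: if A has the descending chain condition and e is
    minimal outside A, meaning that every image of e not in A generates e back,
    then A + [gen [:: e]] has it too. *)
Section Step.
Variables (A : tuple_pred) (e : element).
Hypotheses (Asub : subfunctor A) (Adcc : dcc_fg A).
Hypothesis e_min : forall t (x : 'cV[cyc t]_n), gen [:: e] x ->
  A x \/ gen [:: mk_el x] (el_val e).

(** A tuple y of s congruent to e modulo A and such that subtracting from y an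
    image f y lying in A does not shrink the subfunctor it generates: the part of
    [gen [:: y]] inside A is superfluous, as for a small submodule. *)
Let good s (y : 'cV[cyc (tag e)]_n) : Prop :=
  [/\ gen s y, A (y - el_val e) &
      forall f : {linear cyc (tag e) -> cyc (tag e)}, A (map_mx f y) ->
        gen [:: mk_el (y - map_mx f y)] y].

(** Some generator of s is outside A, hence equals a + f e with f e generating e
    back; applying the corresponding map g yields an element g a + e of s.  Among
    the elements of s congruent to e modulo A, one that generates a minimal
    subfunctor is good, as y - f y is again congruent to e. *)
Lemma good_exists s : subp (gen s) (plusp A (gen [:: e])) ->
  ~ subp (gen s) A -> exists y, good s y.
Proof.
move=> sAe sA; have ssub := gen_subfunctor s; have [_ AD Am] := Asub.
have [e' [e's e'A]] : exists e', e' \in s /\ ~ A (el_val e').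
  apply: contrapT => no; apply: sA; apply: gen_sub => // e' e's.
  by apply: contrapT => e'A; apply: no; exists e'.
have [a [_ [Aa /gen1P [f ->] e'E]]] := sAe _ _ (gen_mem e's).
have [] := @e_min _ (map_mx f (el_val e)).
- by apply/gen1P; exists f.
- by move=> Af; case: e'A; rewrite e'E; exact: AD.
move=> /gen1P [g gE].
(* minimality among the elements of s congruent to e modulo A *)
pose P (d : element) := exists y, [/\ d = mk_el y, gen s y & A (y - el_val e)].
have [|_ [[y [-> sy Ay]] ymin]] := wf_min (P := P) cyc_wf.
  exists (mk_el (map_mx g (el_val e'))); exists (map_mx g (el_val e')); split=> //.
    by apply: subfunctor_map => //; exact: (gen_mem e's).
  by rewrite e'E map_mxD [X in _ + _ - X]gE addrK; exact: Am.
exists y; split=> // f' Af'; set y' := y - map_mx f' y.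
have ysub := gen_subfunctor [:: mk_el y].
have yy : gen [:: mk_el y] y by apply: (@gen_mem _ _ _ (mk_el y)); rewrite inE.
have Py' : P (mk_el y').
  exists y'; split=> //.
    by apply: subfunctorB => //; apply: subfunctor_map.
  by rewrite /y' addrAC; exact: subfunctorB.
apply: contrapT => y'y; apply: (ymin _ Py'); split.
  apply: gen_sub1 => //; apply: subfunctorB => //.
  by apply: subfunctor_map.
by move=> /(_ _ _ yy).
Qed.

(** Writing s as generated by a good y and by D inside A reduces the claim to
    well-founded induction on D.  For a smaller s' with good y', one has
    y - y' = f y + dl with dl in D, so f y is in A and y is generated by
    y - f y = y' + dl.  Hence y may be replaced by y' in the generators of s, and
    s' is generated by y' and some D' inside D; D' = D would force s' = s. *)
Lemma good_acc D s y : Acc (@gen_lt R n) D -> subp (gen D) A ->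
  subp (gen s) (plusp A (gen [:: e])) -> good s y ->
  subp (gen s) (gen (mk_el y :: D)) -> subp (gen D) (gen s) ->
  Acc (@gen_lt R n) s.
Proof.
move=> DA; elim: DA s y => {}D _ IHD s y DA sAe [sy Ay ymin] syD Ds.
split=> s' [s's ss']; have [|s'A] := pselect (subp (gen s') A); first exact: Adcc.
have s'Ae := subp_trans s's sAe.
have [y' [s'y' Ay' y'min]] := good_exists s'Ae s'A.
have [d_sub ssub] := (gen_subfunctor D, gen_subfunctor s).
have y'D_sub := gen_subfunctor (mk_el y' :: D).
have y'D : gen (mk_el y' :: D) y'.
  by apply: (@gen_mem _ _ _ (mk_el y')); rewrite in_cons eqxx.
have DyD : subp (gen D) (gen (mk_el y' :: D)).
  by apply: gen_subset => d; rewrite in_cons => ->; rewrite orbT.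
have sy'D : subp (gen s) (gen (mk_el y' :: D)).
  have [f [dl [Ddl dE]]] : gen (mk_el y :: D) (y - y').
    by apply: syD; apply: subfunctorB => //; exact: s's.
  have Af : A (map_mx f y).
    have -> : map_mx f y = (y - el_val e) - (y' - el_val e) - dl.
      by rewrite opprB addrA subrK dE addrK.
    by apply: subfunctorB => //; [exact: subfunctorB|exact: DA].
  apply: (subp_trans syD); apply: gen_cons_sub => //.
  have yf : gen (mk_el y' :: D) (y - map_mx f y).
    have -> : y - map_mx f y = y' + dl.
      apply/eqP; rewrite subr_eq -addrA [dl + _]addrC -dE.
      by rewrite addrC subrK.
    by case: y'D_sub => _ y'D_add _; apply: y'D_add => //; exact: DyD.
  apply: (gen_sub1 (e := mk_el (y - map_mx f y)) y'D_sub yf).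
  exact: ymin.
have [D' [D'D D's' s'D']] : exists D', [/\ subp (gen D') (gen D),
    subp (gen D') (gen s') & subp (gen s') (gen (mk_el y' :: D'))].
  apply: gen_extract => // X x /s's /sy'D /gen_cons [u [v [yu Dv ->]]].
  by exists v, u; rewrite addrC.
apply: (IHD D' _ s' y' _ s'Ae _ s'D' D's'); [|exact: subp_trans D'D DA|by []].
split=> // DD'; apply: ss'; apply: (subp_trans sy'D).
have s'sub := gen_subfunctor s'; apply: gen_cons_sub => //.
exact: subp_trans DD' D's'.
Qed.

Lemma absorb_minimal : dcc_fg (plusp A (gen [:: e])).
Proof.
move=> s sAe; have [/Adcc //|sA] := pselect (subp (gen s) A).
have [y gy] := good_exists sAe sA; have [sy Ay _] := gy.
have [D [DA Ds syD]] : exists D, [/\ subp (gen D) A, subp (gen D) (gen s) &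
    subp (gen s) (gen (mk_el y :: D))].
  apply: gen_extract => // X x /sAe.
  have [ysub psub] := (gen_subfunctor [:: mk_el y],
    plusp_subfunctor Asub (gen_subfunctor [:: mk_el y])).
  apply: plusp_sub => //; first exact: subp_plusl.
  apply: gen_sub1 => //; exists (- (y - el_val e)), y; split.
  - exact: subfunctorN.
  - by apply: (@gen_mem _ _ _ (mk_el y)); rewrite inE.
  - by rewrite opprB subrK.
exact: good_acc (Adcc DA) DA sAe gy syD Ds.
Qed.

End Step.

(** Absorbable elements form a subfunctor that itself has the descending chain
    condition, so it serves as the largest such subfunctor, and an element minimal
    among the others contradicts [absorb_minimal]. *)
Definition absorbable (e : element) : Prop :=
  forall A, subfunctor A -> dcc_fg A -> dcc_fg (plusp A (gen [:: e])).

Lemma absorb_gen s A : (forall e, e \in s -> absorbable e) -> subfunctor A ->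
  dcc_fg A -> dcc_fg (plusp A (gen s)).
Proof.
elim: s A => [|e s IHs] A sW Asub Adcc.
  by apply: dcc_sub Adcc => X _ [x [_ [Ax -> ->]]]; rewrite addr0.
have esub := gen_subfunctor [:: e].
apply: (dcc_sub (B := plusp (plusp A (gen [:: e])) (gen s))).
  move=> X _ [x [y [Ax /gen_cons [u [v [eu sv ->]]] ->]]].
  by exists (x + u), v; rewrite addrA; split=> //; exists x, u.
apply: IHs; last by apply: sW => //; rewrite in_cons eqxx.
  by move=> e' e's; apply: sW; rewrite in_cons e's orbT.
exact: plusp_subfunctor.
Qed.

Definition absorbed : tuple_pred := fun X x =>
  exists s, (forall e, e \in s -> absorbable e) /\ gen s x.

Lemma absorbed_subfunctor : subfunctor absorbed.
Proof.
split=> [X|X x y [s [sW sx]] [s' [s'W s'y]]|X Y f x [s [sW sx]]].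
- by exists [::].
- exists (s ++ s'); split; last by apply/gen_cat; exists x, y.
  by move=> e; rewrite mem_cat => /orP[/sW|/s'W].
- by exists s; split=> //; apply: subfunctor_map => //; exact: gen_subfunctor.
Qed.

(** A finitely generated subfunctor of A + [absorbed] involves only finitely many
    absorbable elements. *)
Lemma absorbed_dcc A : subfunctor A -> dcc_fg A -> dcc_fg (plusp A absorbed).
Proof.
move=> Asub Adcc s sAW.
have [r [rW sr]] : exists r, (forall e, e \in r -> absorbable e) /\
    subp (gen s) (plusp A (gen r)).
  suff H q : {subset q <= s} -> exists r, (forall e, e \in r -> absorbable e) /\
      subp (gen q) (plusp A (gen r)) by exact: H.
  elim: q => [|e q IHq] qs.
    exists [::]; split=> // X _ ->; exists 0, 0; rewrite addr0.
    by case: Asub => A0 _ _; split.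
  have [|r [rW qr]] := IHq; first by move=> e' e'q; apply: qs; rewrite in_cons e'q orbT.
  have es : e \in s by apply: qs; rewrite in_cons eqxx.
  have [a [w [Aa [r' [r'W r'w]] eE]]] := sAW _ _ (gen_mem es).
  exists (r' ++ r); split.
    by move=> e'; rewrite mem_cat => /orP[/r'W|/rW].
  have [rsub r'sub] := (gen_subfunctor r, gen_subfunctor r').
  have psub := plusp_subfunctor Asub (gen_subfunctor (r' ++ r)).
  apply: gen_cons_sub => //.
    exists a, w; split=> //; apply/gen_cat; exists w, 0; rewrite addr0.
    by case: rsub => r0 _ _; split.
  apply: (subp_trans qr) => X _ [x [y [Ax ry ->]]]; exists x, y; split=> //.
  by apply: gen_subset ry => d; rewrite mem_cat => ->; rewrite orbT.
exact: absorb_gen sr.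
Qed.

(** Induction on e: a proper image x of e is absorbable by the induction
    hypothesis, so e is minimal outside A + [absorbed]. *)
Lemma all_absorbable (e : element) : absorbable e.
Proof.
elim/(well_founded_ind cyc_wf): e => e IHe A Asub Adcc.
have Wsub := absorbed_subfunctor; have psub := plusp_subfunctor Asub Wsub.
have Wdcc := absorbed_dcc Asub Adcc.
apply: (dcc_sub _ (absorb_minimal (e := e) psub Wdcc _)).
  move=> X _ [x [y [Ax ey ->]]]; exists x, y; split=> //.
  exact: subp_plusl Ax.
move=> t x ex; have [|xe] := pselect (gen [:: mk_el x] (el_val e)); first by right.
left; apply: subp_plusr => //; exists [:: mk_el x]; split; last first.
  by apply: (@gen_mem _ _ _ (mk_el x)); rewrite inE.
move=> _ /[!inE] /eqP ->; apply: IHe; split.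
  by apply: gen_sub1 => //; exact: gen_subfunctor.
by move=> /(_ _ _ (gen_mem (mem_head e [::]))).
Qed.

(** The zero subfunctor absorbs the generators of s one at a time. *)
Lemma fg_wf : well_founded (@gen_lt R n).
Proof.
move=> s; have nsub := gen_subfunctor ([::] : seq element).
have ndcc : dcc_fg (gen ([::] : seq element)).
  move=> r rn; split=> q [qr rq]; case: rq; apply: (subp_trans rn) => X x ->.
  by case: (gen_subfunctor q).
have := absorb_gen (s := s) (fun e _ => @all_absorbable e) nsub ndcc.
by apply; exact: subp_plusr.
Qed.

End FinitelyGenerated.

(** * Generated subfunctors as pp formulas *)

Section Formulas.
Variables (R : pzRingType) (n : nat).

(** R/I represents the annihilator condition b y = 0. *)
Lemma cyc_hom_rel (t : presentation R) (X : lmodType R) (a : 'I_n -> R)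
    (x : 'cV[X]_n) :
  (exists f : {linear cyc t -> X}, x = map_mx f (\col_l (a l *: cyc_gen t))) <->
  (exists y : X, (forall i, rels t i 0 *: y = 0) /\ x = \col_l (a l *: y)).
Proof.
split=> [[f ->]|[y [/cyc_lift [f <-] ->]]].
  exists (f (cyc_gen t)); split=> [i|]; first by rewrite -linearZ cyc_gen_rel linear0.
  by apply/colP => l; rewrite !mxE linearZ.
by exists f; apply/colP => l; rewrite !mxE linearZ.
Qed.

Lemma el_valE (e : element R n) : exists a : 'I_n -> R,
  el_val e = \col_l (a l *: cyc_gen (tag e)).
Proof.
have /choice [a aE] := fun l => cyc_genP (el_val e l 0).
by exists a; apply/colP => l; rewrite mxE.
Qed.

Lemma element_formula (e : element R n) : exists phi : ppform R n,
  forall (X : lmodType R) (x : 'cV[X]_n), pp_sat phi X x <-> gen [:: e] x.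
Proof.
have [a eE] := el_valE e.
exists (PPForm (col_mx (\col_l a l) (rels (tag e)))
  (col_mx 1%:M 0 : 'M[R]_(n + tag (tag e), n))) => X x.
have E k (b : 'cV[R]_k) (w : 'cV[X]_1) : mxact b w = \col_i (b i 0 *: w 0 0).
  by apply/colP => i; rewrite !mxE big_ord1.
apply: iff_trans (iff_sym (gen1P e x)); rewrite eE.
apply: iff_trans (iff_sym (cyc_hom_rel (tag e) a x)).
split=> [[w]|[y [hy ->]]].
  rewrite /= !mxact_col mxact1 mxact0 => /eq_col_mx[wx /colP w0].
  exists (w 0 0); split=> [i|]; first by have := w0 i; rewrite E !mxE.
  by rewrite -wx E; apply/colP => l; rewrite !mxE.
exists (const_mx y); rewrite /= !mxact_col mxact1 mxact0 !E.
by congr col_mx; apply/colP => l; rewrite !mxE.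
Qed.

Lemma gen_formula (s : seq (element R n)) : exists phi : ppform R n,
  forall (X : lmodType R) (x : 'cV[X]_n), pp_sat phi X x <-> gen s x.
Proof.
elim: s => [|e s [phi phiE]].
  exists (PPForm (0 : 'M[R]_(n, 0)) 1%:M) => X x /=.
  by split=> [[y]|->]; [|exists 0]; rewrite /= mxact0 mxact1.
have [psi psiE] := element_formula e; exists (pp_sum psi phi) => X x.
apply: (iff_trans (pp_sumP _ _ _)); apply: iff_trans (iff_sym (gen_cons _ _ _)).
split=> [[u [v [-> /psiE eu /phiE sv]]]|[u [v [/psiE eu /phiE sv ->]]]];
  by exists u, v.
Qed.

End Formulas.

Lemma Gamma1_gen (R : pzRingType) (n : nat) (phi : ppform R n) : Gamma1 phi ->
  exists s : seq (element R n),
    forall (X : lmodType R) (x : 'cV[X]_n), pp_sat phi X x <-> gen s x.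
Proof.
elim=> [a k b|{}phi psi _ [s sE] _ [r rE]].
  pose t : presentation R := Tagged (fun k => 'cV[R]_k) b.
  exists [:: mk_el (\col_(l < 1) (a *: cyc_gen t))] => X x.
  apply: iff_trans (iff_sym (gen1P _ _)).
  apply: iff_trans (iff_sym (cyc_hom_rel t (fun=> a) x)).
  have -> : x = const_mx (x 0 0) by apply/colP => l; rewrite !mxE ord1.
  apply: (iff_trans (pp_cycP a b _)); split=> [[y [-> yb]]|[y [yb xy]]].
    by exists y; split=> //; apply/colP => l; rewrite !mxE.
  by exists y; split=> //; move/colP/(_ 0): xy; rewrite !mxE.
exists (s ++ r) => X x.
apply: (iff_trans (pp_sumP _ _ _)); apply: iff_trans (iff_sym (gen_cat _ _ _)).
split=> [[u [v [-> /sE eu /rE sv]]]|[u [v [/sE eu /rE sv ->]]]];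
  by exists u, v.
Qed.

(** * Well-foundedness for one generator *)

Lemma no_chain_wf (T : Type) (lt : T -> T -> Prop) :
  (forall u : nat -> T, exists i, ~ lt (u i.+1) (u i)) -> well_founded lt.
Proof.
move=> noChain x; apply: contrapT => xA.
have next (y : {y | ~ Acc lt y}) : exists z : {z | ~ Acc lt z}, lt (sval z) (sval y).
  apply: contrapT => no; apply: (svalP y); split=> z zy.
  by apply: contrapT => zA; apply: no; exists (exist _ z zA).
have [f fE] := choice next.
have [i []] := noChain (fun i => sval (iter i f (exist _ x xA))).
exact: fE.
Qed.

Lemma dsum_cyc_Add (R : pzRingType) (I : Type) (t : I -> presentation R) :
  Add_class (@cyclic_fp R) (dsum (fun i => cyc (t i))).
Proof.
exists I, (fun i => cyc (t i)); split; last exact: direct_summand_refl.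
by move=> i; exists (tag (t i)), (rels (t i)), idfun; exists idfun.
Qed.

(** The formula gamma_i says that x is the image of q_i under a linear map from
    the i-th module.  The chain of these formulas stabilizes in the direct sum of
    all the modules, and projecting a witness to the N-th component gives a map
    that takes q_(N+1) back to q_N. *)
Lemma cyclic_chain_stops (R : pzRingType) (t : nat -> presentation R)
    (f : forall i, {linear cyc (t i) -> cyc (t i.+1)})
    (q : forall i, cyc (t i)) :
  has_dcc (@Gamma1 R) (Add_class (@cyclic_fp R)) ->
  (forall i, q i.+1 = f i (q i)) ->
  exists i (g : {linear cyc (t i.+1) -> cyc (t i)}), g (q i.+1) = q i.
Proof.
move=> dcc qE; have /choice [r rE] := fun i => cyc_genP (q i).
pose gamma i : ppform R 1 := pp_cyc (r i) (rels (t i)).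
have gammaP i (X : lmodType R) (x : 'cV[X]_1) : pp_sat (gamma i) X x <->
    exists h : {linear cyc (t i) -> X}, x 0 0 = h (q i).
  have -> : x = const_mx (x 0 0) by apply/colP => l; rewrite !mxE ord1.
  apply: (iff_trans (pp_cycP _ _ _)); rewrite mxE; split=> [[y [-> yb]]|[h ->]].
    by have [h <-] := cyc_lift yb; exists h; rewrite rE linearZ.
  exists (h (cyc_gen (t i))); split=> [|j]; first by rewrite rE linearZ.
  by rewrite -linearZ cyc_gen_rel linear0.
have gamma_le i : pp_le (gamma i.+1) (gamma i).
  move=> X x /gammaP [h hx]; apply/gammaP; exists (h \o f i).
  by rewrite hx qE.
have [N NE] := dcc _ (dsum_cyc_Add t) 1%N gamma (fun i => Gamma1_cyc _ _) gamma_le.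
have [j [jE _]] := dsum_inj (fun i => cyc (t i)) N.
have [p pE] := dsum_proj (fun i => cyc (t i)) N.
have : pp_sat (gamma N) _ (const_mx (j (q N))).
  by apply/gammaP; exists j; rewrite mxE.
rewrite -(NE N.+1) // => /gammaP [h]; rewrite mxE => jqE.
by exists N, (p \o h); rewrite /= -jqE pE jE.
Qed.

(** In a strictly descending chain e_0, e_1, ..., all the coordinates of e_i are
    multiples a_l q_i of the image q_i of the generator of the first module, with
    the same coefficients a_l for every i; a map taking q_(i+1) to q_i takes
    e_(i+1) to e_i. *)
Lemma cyclic_gen_wf (R : pzRingType) (n : nat) :
  has_dcc (@Gamma1 R) (Add_class (@cyclic_fp R)) ->
  well_founded (fun e' e : element R n => gen_lt [:: e'] [:: e]).
Proof.
move=> dcc; apply: no_chain_wf => u; apply: contrapT => noStop.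
have {}noStop i : gen_lt [:: u i.+1] [:: u i].
  by apply: contrapT => no; apply: noStop; exists i.
have fex i : exists f : {linear cyc (tag (u i)) -> cyc (tag (u i.+1))},
    el_val (u i.+1) = map_mx f (el_val (u i)).
  by apply/gen1P/(noStop i).1/gen_mem/mem_head.
pose f i := projT1 (cid (fex i)).
have fE i : el_val (u i.+1) = map_mx (f i) (el_val (u i)) := projT2 (cid (fex i)).
pose q := nat_rect (fun i => cyc (tag (u i))) (cyc_gen (tag (u 0%N))) f.
have [a aE] := el_valE (u 0%N).
have uE i : el_val (u i) = \col_l (a l *: q i).
  elim: i => // i IHi; rewrite fE IHi; apply/colP => l.
  by rewrite !mxE linearZ.
have [i [g gE]] := cyclic_chain_stops (f := f) (q := q) dcc (fun i => erefl).
have [_] := noStop i; apply; apply: gen_sub1; first exact: gen_subfunctor.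
apply/gen1P; exists g; rewrite !uE; apply/colP => l.
by rewrite !mxE linearZ gE.
Qed.

(** * Direct limits *)

Lemma mxact_map (R : pzRingType) (X Y : lmodType R) (h : {linear X -> Y}) m n
    (A : 'M[R]_(m, n)) x :
  mxact A (map_mx h x) = map_mx h (mxact A x).
Proof.
apply/colP => l; rewrite !mxE linear_sum; apply: eq_bigr => j _.
by rewrite linearZ mxE.
Qed.

Lemma pp_sat_map (R : pzRingType) (X Y : lmodType R) (h : {linear X -> Y}) n
    (psi : ppform R n) x :
  pp_sat psi X x -> pp_sat psi Y (map_mx h x).
Proof.
by move=> [y xy]; exists (map_mx h y); rewrite !mxact_map xy.
Qed.

Section Threads.
Variables (R : pzRingType) (d : Order.disp_t) (I : porderType d).
Variables (S : direct_system R I) (hI : directed I).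

Lemma ds_map_irr i j (h h' : (i <= j)%O) : ds_map S h =1 ds_map S h'.
Proof. by move=> x; rewrite (bool_irrelevance h h'). Qed.

(** The direct limit is built as the module of families that are eventually
    compatible, modulo those that are eventually zero.  Unlike in the quotient of
    the disjoint union, the operations are defined componentwise, without a choice
    of upper bounds. *)
Definition eventual_thread (x : forall i, S i) : Prop :=
  exists N, forall j k (jk : (j <= k)%O), (N <= j)%O -> ds_map S jk (x j) = x k.

Record thread : Type := Thread {
  thread_fun :> forall i, S i;
  thread_ev : eventual_thread thread_fun }.

HB.instance Definition _ := gen_eqMixin thread.
HB.instance Definition _ := gen_choiceMixin thread.

Lemma threadP (x y : thread) : (forall i, x i = y i) -> x = y.
Proof.
case: x y => [x hx] [y hy] /= xy.
have exy : x = y by apply: functional_extensionality_dep.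
by case: y / exy hy {xy} => hy; rewrite (Prop_irrelevance hx hy).
Qed.

Lemma thread0 : eventual_thread (fun i => 0).
Proof. by have [[i] _] := hI; exists i => j k jk _; rewrite linear0. Qed.

Lemma threadN (x : thread) : eventual_thread (fun i => - x i).
Proof. by have [N xN] := thread_ev x; exists N => j k jk Nj; rewrite linearN xN. Qed.

Lemma threadD (x y : thread) : eventual_thread (fun i => x i + y i).
Proof.
have [[N xN] [M yM]] := (thread_ev x, thread_ev y).
have [P [NP MP]] := hI.2 N M; exists P => j k jk Pj.
by rewrite linearD xN ?yM ?(le_trans MP) ?(le_trans NP).
Qed.

Lemma threadZ (a : R) (x : thread) : eventual_thread (fun i => a *: x i).
Proof. by have [N xN] := thread_ev x; exists N => j k jk Nj; rewrite linearZ xN. Qed.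

Let zero := Thread thread0.
Let opp x := Thread (threadN x).
Let add x y := Thread (threadD x y).
Let scale a x := Thread (threadZ a x).

Let addA : associative add.
Proof. by move=> x y z; apply: threadP => i; apply: addrA. Qed.
Let addC : commutative add.
Proof. by move=> x y; apply: threadP => i; apply: addrC. Qed.
Let add0 : left_id zero add.
Proof. by move=> x; apply: threadP => i; apply: add0r. Qed.
Let addN : left_inverse zero opp add.
Proof. by move=> x; apply: threadP => i; apply: addNr. Qed.

HB.instance Definition _ := GRing.isZmodule.Build thread addA addC add0 addN.

Let scaleA a b v : scale a (scale b v) = scale (a * b) v.
Proof. by apply: threadP => i; apply: scalerA. Qed.
Let scale1 : left_id 1 scale.
Proof. by move=> x; apply: threadP => i; apply: scale1r. Qed.
Let scaleDr : right_distributive scale +%R.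
Proof. by move=> a x y; apply: threadP => i; apply: scalerDr. Qed.
Let scaleDl v : {morph scale^~ v : a b / a + b}.
Proof. by move=> a b; apply: threadP => i; apply: scalerDl. Qed.

HB.instance Definition _ :=
  GRing.Zmodule_isLmodule.Build R thread scaleA scale1 scaleDr scaleDl.

Definition eventually0 : {pred thread} :=
  fun x => `[< exists N, forall j, (N <= j)%O -> x j = 0 >].

Lemma eventually0P (x : thread) :
  reflect (exists N, forall j, (N <= j)%O -> x j = 0) (x \in eventually0).
Proof. exact: asboolP. Qed.

Lemma eventually0_zmod_closed : zmod_closed eventually0.
Proof.
split=> [|x y /eventually0P[N xN] /eventually0P[M yM]]; apply/eventually0P.
  by have [[i] _] := hI; exists i.
have [P [NP MP]] := hI.2 N M; exists P => j Pj.
have -> : (x - y) j = x j - y j by [].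
by rewrite xN ?yM ?subr0 ?(le_trans MP) ?(le_trans NP).
Qed.

HB.instance Definition _ :=
  GRing.isZmodClosed.Build thread eventually0 eventually0_zmod_closed.

Lemma eventually0_scale (a : R) x : x \in eventually0 -> a *: x \in eventually0.
Proof.
move=> /eventually0P[N xN]; apply/eventually0P; exists N => j Nj.
have -> : (a *: x) j = a *: x j by [].
by rewrite xN ?scaler0.
Qed.

Definition colim : Type := Quotient.quot (eventually0 : zmodClosed thread).
HB.instance Definition _ := GRing.Zmodule.on colim.

Definition colim_pi (x : thread) : colim :=
  (\pi_(Quotient.quot (eventually0 : zmodClosed thread)) x)%qT.
Let rep (q : colim) : thread := repr q.

Let repK q : colim_pi (rep q) = q. Proof. exact: reprK. Qed.

Lemma colim_piP (x y : thread) :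
  colim_pi x = colim_pi y <-> x - y \in eventually0.
Proof.
by rewrite /colim_pi; split => [/eqP|h]; [|apply/eqP]; rewrite -Quotient.idealrBE.
Qed.

Lemma colim_piD x y : colim_pi (x + y) = colim_pi x + colim_pi y.
Proof. exact: Quotient.pi_add. Qed.

Definition colim_scale (a : R) (q : colim) : colim := colim_pi (a *: rep q).

Lemma colim_scale_pi a x : colim_scale a (colim_pi x) = colim_pi (a *: x).
Proof. by apply/colim_piP; rewrite -scalerBr; apply/eventually0_scale/colim_piP/repK. Qed.

Let qscaleA a c v : colim_scale a (colim_scale c v) = colim_scale (a * c) v.
Proof. by rewrite -[v]repK !colim_scale_pi scalerA. Qed.
Let qscale1 : left_id 1 colim_scale.
Proof. by move=> v; rewrite -[v]repK colim_scale_pi scale1r. Qed.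
Let qscaleDr : right_distributive colim_scale +%R.
Proof.
by move=> a x y; rewrite -[x]repK -[y]repK -colim_piD !colim_scale_pi scalerDr colim_piD.
Qed.
Let qscaleDl v : {morph colim_scale^~ v : a c / a + c}.
Proof. by move=> a c; rewrite -[v]repK !colim_scale_pi scalerDl colim_piD. Qed.

HB.instance Definition _ :=
  GRing.Zmodule_isLmodule.Build R colim qscaleA qscale1 qscaleDr qscaleDl.

Definition germ i (y : S i) : forall j, S j := fun j =>
  if pselect (i <= j)%O is left ij then ds_map S ij y else 0.

Lemma germE i j (ij : (i <= j)%O) y : germ y j = ds_map S ij y.
Proof. by rewrite /germ; case: pselect => // ij'; exact: ds_map_irr. Qed.

Lemma germ_thread i (y : S i) : eventual_thread (germ y).
Proof.
exists i => j k jk ij; rewrite (germE ij) (germE (le_trans ij jk)).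
exact: ds_comp.
Qed.

(** The description of direct limits by elements. *)
Definition concrete_limit (L : lmodType R) (f : forall i, {linear S i -> L}) : Prop :=
  [/\ is_cocone f, forall x, exists i y, x = f i y &
      forall i y, f i y = 0 -> exists j (ij : (i <= j)%O), ds_map S ij y = 0].

Lemma concrete_limit_exists :
  exists (L : lmodType R) (f : forall i, {linear S i -> L}), concrete_limit f.
Proof.
have fex i : exists f : {linear S i -> colim},
    forall y, f y = colim_pi (Thread (germ_thread y)).
  apply: linear_pack => a x y.
  have -> (b : R) (z : colim) : b *: z = colim_scale b z by [].
  rewrite colim_scale_pi -colim_piD; congr colim_pi; apply: threadP => j /=.
  change (germ (a *: x + y) j = a *: germ x j + germ y j).
  rewrite /germ; case: pselect => [ij|_]; first by rewrite linearP.
  by rewrite scaler0 addr0.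
pose f i := projT1 (cid (fex i)).
have fE i y : f i y = colim_pi (Thread (germ_thread y)) := projT2 (cid (fex i)) y.
have sub_pi (x y : thread) : (exists N, forall j, (N <= j)%O -> x j = y j) ->
    colim_pi x = colim_pi y.
  move=> [N xy]; apply/colim_piP/eventually0P; exists N => j Nj.
  have -> : (x - y) j = x j - y j by [].
  by rewrite xy ?subrr.
exists colim, f; split=> [i j ij x|x|i y].
- rewrite !fE; apply: sub_pi; exists j => k jk /=.
  by rewrite (germE jk) (germE (le_trans ij jk)); exact: ds_comp.
- rewrite -[x]repK; have [N xN] := thread_ev (rep x).
  exists N, (rep x N); rewrite fE; apply: sub_pi; exists N => k Nk /=.
  by rewrite (germE Nk) xN.
- move=> y0; have /colim_piP : colim_pi (Thread (germ_thread y)) = colim_pi 0.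
    by rewrite -fE y0 -[RHS](addrK (colim_pi 0)) -colim_piD addr0 subrr.
  rewrite subr0 => /eventually0P[N yN].
  have [j [ij Nj]] := hI.2 i N; exists j, ij.
  by rewrite -germE; exact: yN.
Qed.

Lemma concrete_limit_eq (L : lmodType R) (f : forall i, {linear S i -> L}) :
  concrete_limit f -> forall i j (y : S i) (z : S j), f i y = f j z ->
  exists k (ik : (i <= k)%O) (jk : (j <= k)%O), ds_map S ik y = ds_map S jk z.
Proof.
move=> [fco _ fker] i j y z yz; have [k [ik jk]] := hI.2 i j.
have : f k (ds_map S ik y - ds_map S jk z) = 0.
  by rewrite linearB !fco yz subrr.
move=> /fker [l [kl /eqP]]; rewrite linearB subr_eq0 => /eqP e.
exists l, (le_trans ik kl), (le_trans jk kl).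
by rewrite -(ds_comp ik kl) -(ds_comp jk kl).
Qed.

Lemma concrete_limit_universal (L : lmodType R) (f : forall i, {linear S i -> L}) :
  concrete_limit f ->
  forall (X : lmodType R) (g : forall i, {linear S i -> X}), is_cocone g ->
  exists h : {linear L -> X}, (forall i x, h (f i x) = g i x) /\
    forall h' : {linear L -> X}, (forall i x, h' (f i x) = g i x) -> h' =1 h.
Proof.
move=> fL X g gco; have [fco fsurj _] := fL.
have gf i j (y : S i) (z : S j) : f i y = f j z -> g i y = g j z.
  by move=> /(concrete_limit_eq fL) [k [ik [jk e]]]; rewrite -(gco _ _ ik) e gco.
have /choice [u uE] : forall x, exists u : {i & S i}, x = f (tag u) (tagged u).
  by move=> x; have [i [y ->]] := fsurj x; exists (Tagged (fun i => ds_obj S i) y).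
pose h x := g (tag (u x)) (tagged (u x)).
have hf i y : h (f i y) = g i y by apply: gf; rewrite -uE.
have hL : linear h.
  move=> a x x'; have [[i [y ->]] [j [z ->]]] := (fsurj x, fsurj x').
  have [k [ik jk]] := hI.2 i j.
  by rewrite -(fco _ _ ik) -(fco _ _ jk) -linearP !hf linearP.
have [h' h'E] := linear_pack hL; exists h'; split=> [i x|h'' h''E x].
  by rewrite h'E hf.
by have [i [y ->]] := fsurj x; rewrite h''E h'E hf.
Qed.

Lemma concrete_is_direct_limit (L : lmodType R) (f : forall i, {linear S i -> L}) :
  concrete_limit f -> is_direct_limit S L.
Proof.
move=> fL; exists f; split; first by case: fL.
exact: concrete_limit_universal.
Qed.

(** The universal property gives mutually inverse comparison maps with the
    constructed limit; the identity h' h = id transports both conditions to L. *)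
Lemma direct_limit_concrete (L : lmodType R) : is_direct_limit S L ->
  exists f : forall i, {linear S i -> L}, concrete_limit f.
Proof.
move=> [f [fco fU]]; exists f.
have [L' [f' f'L]] := concrete_limit_exists; have [f'co f'surj f'ker] := f'L.
have [h [hf _]] := fU L' f' f'co.
have [h' [h'f' _]] := concrete_limit_universal f'L fco.
have h'h x : h' (h x) = x.
  have [g [_ gU]] := fU L f fco.
  rewrite -[LHS]/((h' \o h) x) gU; last by move=> i y /=; rewrite hf h'f'.
  by rewrite -(gU idfun).
split=> // [x|i y fy0].
  by have [i [y hxE]] := f'surj (h x); exists i, y; rewrite -[LHS]h'h hxE h'f'.
by apply: f'ker; rewrite -hf fy0 linear0.
Qed.

(** Finitely many conditions, each holding from some stage on, hold together at a
    common stage beyond i. *)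
Lemma directed_fin m (P : 'I_m -> I -> Prop) (i : I) :
  (forall l, exists k, forall j, (k <= j)%O -> P l j) ->
  exists2 k, (i <= k)%O & forall l, P l k.
Proof.
move=> /choice [k kP].
suff [j [ij kj]] : exists j, (i <= j)%O /\ forall l, (k l <= j)%O.
  by exists j => // l; apply: kP.
suff [j [ij kj]] : exists j, (i <= j)%O /\ forall l, l \in enum 'I_m -> (k l <= j)%O.
  by exists j; split=> // l; apply: kj; rewrite mem_enum.
elim: (enum 'I_m) => [|l r [j [ij kj]]]; first by exists i.
have [j' [jj' lj']] := hI.2 j (k l); exists j'; split; first exact: le_trans ij jj'.
by move=> l' /[!in_cons] /orP[/eqP ->//|/kj /le_trans]; apply.
Qed.

Section ConcreteLimit.
Variables (L : lmodType R) (f : forall i, {linear S i -> L}).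
Hypothesis fL : concrete_limit f.

Lemma limit_tuple m (x : 'cV[L]_m) (i : I) :
  exists k (ik : (i <= k)%O) (y : 'cV[S k]_m), x = map_mx (f k) y.
Proof.
have [fco fsurj _] := fL.
have [l|k ik kP] := @directed_fin m (fun l k => exists y, x l 0 = f k y) i.
  have [j [y xE]] := fsurj (x l 0); exists j => k jk.
  by exists (ds_map S jk y); rewrite fco.
have [y yE] := choice kP; exists k, ik, (\col_l y l).
by apply/colP => l; rewrite !mxE.
Qed.

Lemma limit_tuple0 m i (x : 'cV[S i]_m) : map_mx (f i) x = 0 ->
  exists k (ik : (i <= k)%O), map_mx (ds_map S ik) x = 0.
Proof.
move=> x0; have [_ _ fker] := fL.
have [l|k ik kP] := @directed_fin m
    (fun l k => forall ik : (i <= k)%O, ds_map S ik (x l 0) = 0) i.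
  have [|j [ij xj]] := fker i (x l 0); first by move/colP/(_ l): x0; rewrite !mxE.
  by exists j => k jk ik; rewrite -(ds_comp ij jk) xj linear0.
by exists k, ik; apply/colP => l; rewrite !mxE kP.
Qed.

(** The witnesses and then the finitely many equations of psi lift to a later
    stage. *)
Lemma pp_sat_limit n (psi : ppform R n) i (x : 'cV[S i]_n) :
  pp_sat psi L (map_mx (f i) x) ->
  exists k (ik : (i <= k)%O), pp_sat psi (S k) (map_mx (ds_map S ik) x).
Proof.
have [fco _ _] := fL; move=> [y xy].
have [j [ij [z yE]]] := limit_tuple y i.
have fx : map_mx (f j) (map_mx (ds_map S ij) x) = map_mx (f i) x.
  by apply/colP => l; rewrite !mxE fco.
have : map_mx (f j) (mxact (pp_lhs psi) z -
    mxact (pp_rhs psi) (map_mx (ds_map S ij) x)) = 0.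
  by rewrite map_mxB -!mxact_map -yE fx xy subrr.
move=> /limit_tuple0 [k [jk /eqP]]; rewrite map_mxB subr_eq0 -!mxact_map => /eqP e.
exists k, (le_trans ij jk); exists (map_mx (ds_map S jk) z); rewrite e.
by congr mxact; apply/colP => l; rewrite !mxE; exact: ds_comp.
Qed.

End ConcreteLimit.

End Threads.

(** * Free realizations in add(A_cyc) *)

Section Realization.
Variables (R : pzRingType) (n : nat).

(** For the formula defined by s, this says that (M, m) is a free realization. *)
Definition realizes (M : lmodType R) (m : 'cV[M]_n) (s : seq (element R n)) :=
  forall (X : lmodType R) (x : 'cV[X]_n),
    gen s x <-> exists h : {linear M -> X}, x = map_mx h m.

Lemma hom_image_subfunctor (M : lmodType R) (m : 'cV[M]_n) :
  subfunctor (fun X x => exists h : {linear M -> X}, x = map_mx h m).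
Proof.
split=> [X|X x y [h ->] [k ->]|X Y f x [h ->]].
- by exists \0; apply/colP => l; rewrite !mxE.
- by exists (h \+ k); apply/colP => l; rewrite !mxE.
- by exists (f \o h); apply/colP => l; rewrite !mxE.
Qed.

(** The list consists of the components of m in the cyclic summands. *)
Lemma add_class_realizes (M : lmodType R) (m : 'cV[M]_n) :
  add_class (@cyclic_fp R) M -> exists s, realizes m s.
Proof.
move=> /add_class_retract [r [t [f [g fgE]]]].
pose e j : element R n := mk_el (map_mx (f j) m).
exists [seq e j | j <- enum 'I_r] => X x.
have ssub := gen_subfunctor [seq e j | j <- enum 'I_r].
split=> [|[h ->]].
  apply: (gen_sub (hom_image_subfunctor m)) => _ /mapP [j _ ->].
  by exists (f j).
apply: subfunctor_map => //.
have -> : m = \sum_j map_mx (g j) (map_mx (f j) m).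
  apply/colP => l; rewrite summxE {1}[m l 0]fgE.
  by apply: eq_bigr => j _; rewrite !mxE.
apply: subfunctor_sum => // j; apply: subfunctor_map => //.
by apply: (gen_mem (e := e j)); apply: map_f; rewrite mem_enum.
Qed.

(** The tuple m is the sum of the generators, each in its own summand of the
    direct sum of their modules. *)
Lemma realizes_add_class (s : seq (element R n)) :
  exists (M : lmodType R) (m : 'cV[M]_n),
    add_class (@cyclic_fp R) M /\ realizes m s.
Proof.
pose N (i : 'I_(size s)) := cyc (tag (tnth (in_tuple s) i)).
pose v (i : 'I_(size s)) : 'cV[N i]_n := el_val (tnth (in_tuple s) i).
pose p i := projT1 (cid (dsum_proj N i)).
have pE i x : p i x = x i := projT2 (cid (dsum_proj N i)) x.
pose j i := projT1 (cid (dsum_inj N i)).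
have jE i := projT2 (cid (dsum_inj N i)).
pose m : 'cV[dsum N]_n := \sum_i map_mx (j i) (v i).
exists (dsum N), m; split.
  exists (size s), N; split; last exact: direct_summand_refl.
  move=> i; exists (tag (tag (tnth (in_tuple s) i))), (rels (tag (tnth (in_tuple s) i))), idfun.
  by exists idfun.
move=> X x; have ssub := gen_subfunctor s; split=> [|[h ->]].
  apply: (gen_sub (hom_image_subfunctor m)) => e /(tnthP (in_tuple s)) [i ->].
  exists (p i); apply/colP => l; rewrite [RHS]mxE summxE pE dsum_fun_sum.
  rewrite (bigD1 i) //= mxE (jE i).1 big1 ?addr0 // => k ki.
  by rewrite mxE (jE k).2.
apply: subfunctor_map => //; apply: subfunctor_sum => // i.
by apply: subfunctor_map => //; apply: gen_mem; exact: mem_tnth.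
Qed.

End Realization.

(** * Direct systems indexed by the natural numbers *)

Section ChainSystem.
Variables (R : pzRingType) (D : nat -> lmodType R).
Variable g : forall i, {linear D i -> D i.+1}.

Definition chain_cast i j (e : i = j) : {linear D i -> D j} :=
  ecast j {linear D i -> D j} e idfun.

(** Recursion on the target avoids arithmetic on indices in types: only the
    identity map needs a transport.  The value is 0 for i > j. *)
Fixpoint chain_map (i j : nat) : {linear D i -> D j} :=
  if pselect (i = j) is left e then chain_cast e else
  if j is j'.+1 then g j' \o chain_map i j' else \0.

Lemma chain_map_id i x : chain_map i i x = x.
Proof.
have E (e : i = i) : chain_cast e x = x by rewrite (eq_irrelevance e erefl).
by case: i x E => [|i] x E /=; case: pselect.
Qed.

Lemma chain_mapS i j x : (i <= j)%N -> chain_map i j.+1 x = g j (chain_map i j x).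
Proof.
move=> ij /=; case: pselect => // e; move: ij; rewrite {1}e ltnn; exact.
Qed.

Lemma chain_map_comp i j k x : (i <= j)%N -> (j <= k)%N ->
  chain_map j k (chain_map i j x) = chain_map i k x.
Proof.
move=> ij; elim: k => [|k IHk] jk.
  by move: jk; rewrite leqn0 => /eqP ->; rewrite chain_map_id.
move: jk; rewrite leq_eqVlt => /orP[/eqP jk|]; last first.
  by rewrite ltnS => jk; rewrite !chain_mapS ?IHk // (leq_trans ij).
by rewrite -jk chain_map_id.
Qed.

Definition chain_system : direct_system R nat :=
  @DirectSystem R _ nat D (fun i j _ => chain_map i j)
    (fun i _ x => chain_map_id x)
    (fun i j k ij jk _ x => chain_map_comp x ij jk).

Lemma chain_system_step i (h : (i <= i.+1)%O) x :
  ds_map chain_system h x = g i x.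
Proof. by rewrite [LHS]chain_mapS // chain_map_id. Qed.

Lemma nat_directed : directed nat.
Proof.
split=> [|i j]; first exact: (inhabits 0%N).
by exists (maxn i j); rewrite !leEnat leq_maxl leq_maxr.
Qed.

End ChainSystem.

(** * The two implications *)

Section Main.
Variable R : pzRingType.

Definition limits_mittag_leffler : Prop :=
  forall (d : Order.disp_t) (I : porderType d) (S : direct_system R I),
    directed I -> (forall i : I, add_class (@cyclic_fp R) (S i)) ->
    forall L : lmodType R, is_direct_limit S L -> mittag_leffler L.

Lemma dcc_limits_mittag_leffler :
  has_dcc (@Gamma1 R) (Add_class (@cyclic_fp R)) -> limits_mittag_leffler.
Proof.
move=> dcc d I S dI Sadd L Llim n a.
have [f fL] := direct_limit_concrete dI Llim; have [[i0] _] := dI.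
(* s is freely realized by a preimage of a at some stage *)
pose P s := exists k (m : 'cV[S k]_n), a = map_mx (f k) m /\ realizes m s.
have [|s [[k [m [am ms]]] smin]] := wf_min (P := P) (fg_wf (cyclic_gen_wf dcc)).
  have [k [_ [m am]]] := limit_tuple dI fL a i0.
  have [s ms] := add_class_realizes m (Sadd k).
  by exists s, k, m.
have [phi phiE] := gen_formula s.
exists phi; first by apply/phiE/ms; exists (f k).
move=> psi; rewrite /pp_type /= am => /(pp_sat_limit dI fL) [j [kj psij]].
have [s' ms'] := add_class_realizes (map_mx (ds_map S kj) m) (Sadd j).
have Ps' : P s'.
  exists j, (map_mx (ds_map S kj) m); split=> //; rewrite am.
  by have [fco _ _] := fL; apply/colP => l; rewrite !mxE fco.
(* the later preimage satisfies more formulas; minimality makes s' equivalent to s *)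
have s's : subp (gen s') (gen s).
  move=> X x /ms' [h ->]; apply/ms; exists (h \o ds_map S kj).
  by apply/colP => l; rewrite !mxE.
have ss' : subp (gen s) (gen s').
  by apply: contrapT => no; apply: (smin _ Ps').
by move=> X x /phiE /ss' /ms' [h ->]; exact: pp_sat_map.
Qed.

Lemma limits_mittag_leffler_dcc :
  limits_mittag_leffler -> has_dcc (@Gamma1 R) (fun _ : lmodType R => True).
Proof.
move=> ML M _ n gamma gammaG gammaD.
have /choice [s sE] := fun i => Gamma1_gen (gammaG i).
have real i := realizes_add_class (s i).
pose D i := projT1 (cid (real i)); pose m i := projT1 (cid (projT2 (cid (real i)))).
have [Dadd ms] : (forall i, add_class (@cyclic_fp R) (D i)) /\
    forall i, realizes (m i) (s i).
  by split=> i; case: (projT2 (cid (projT2 (cid (real i))))).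
have gammaE i (X : lmodType R) (x : 'cV[X]_n) : pp_sat (gamma i) X x <->
    exists h : {linear D i -> X}, x = map_mx h (m i).
  exact: iff_trans (sE i X x) (ms i X x).
have gex i : exists g : {linear D i -> D i.+1}, m i.+1 = map_mx g (m i).
  apply/gammaE/gammaD/gammaE; exists idfun.
  by apply/colP => l; rewrite mxE.
pose g i := projT1 (cid (gex i)).
have gE i : m i.+1 = map_mx (g i) (m i) := projT2 (cid (gex i)).
pose S := chain_system g.
have [L [f fL]] := concrete_limit_exists S nat_directed.
have [fco _ _] := fL.
pose a := map_mx (f 0%N) (m 0%N).
have fm i : map_mx (f i) (m i) = a.
  elim: i => // i <-; rewrite gE; apply/colP => l; rewrite !mxE.
  by rewrite -(chain_system_step (g := g) (leqnSn i)) fco.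
have mE i j (ij : (i <= j)%O) : map_mx (ds_map S ij) (m i) = m j.
  elim: j ij => [|j IHj] ij.
    have i0 : i = 0%N by move: (ij); rewrite leEnat leqn0 => /eqP.
    by subst i; apply/colP => l; rewrite mxE ds_id.
  have : (i == j.+1) || (i < j.+1)%N by rewrite -leq_eqVlt.
  case/orP=> [/eqP e|].
    by subst i; apply/colP => l; rewrite mxE ds_id.
  rewrite ltnS => le_ij; have ij' : (i <= j)%O by [].
  rewrite gE -(IHj ij'); apply/colP => l; rewrite !mxE.
  by rewrite -(chain_system_step (g := g) (leqnSn j)) (ds_comp ij' _ ij).
(* phi lies below every gamma j, and above gamma N, as it holds at stage N *)
have [phi phia phimin] := ML _ _ S nat_directed Dadd L
  (concrete_is_direct_limit nat_directed fL) n a.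
have [N [N0 phiN]] := pp_sat_limit nat_directed fL (x := m 0%N) phia.
rewrite mE in phiN; exists N => j Nj; apply/seteqP; split=> x; last first.
  move=> /gammaE [h ->]; apply: (phimin (gamma j)); last exact: pp_sat_map.
  by apply/gammaE; exists (f j); rewrite fm.
elim: j Nj => [|j IHj]; first by rewrite leqn0 => /eqP ->.
rewrite leq_eqVlt => /orP[/eqP ->//|/IHj jN] /gammaD; exact: jN.
Qed.

End Main.

Theorem mainTheorem5 (R : pzRingType) :
  [<-> (* (1)  *) has_dcc (@Gamma1 R) (fun _ : lmodType R => True);
       (* (1') *) has_dcc (@Gamma1 R) (Add_class (@cyclic_fp R));
       (* (2)  *) forall (d : Order.disp_t) (I : porderType d)
                    (S : direct_system R I),
                    directed I -> (forall i : I, add_class (@cyclic_fp R) (S i)) ->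
                    forall L : lmodType R, is_direct_limit S L ->
                    mittag_leffler L].
Proof.
tfae.
- by move=> dcc M _; exact: dcc.
- exact: dcc_limits_mittag_leffler.
- exact: limits_mittag_leffler_dcc.
Qed.
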